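(* Let $(\mathbf{Top}\downarrow\mathbb{R})$ be the category of $\mathbb{R}$-spaces with the flow $\mathcal{T}$ given by $\mathcal{T}_\varepsilon(\mathbb{X},f)=(\mathbb{X}\times[-\varepsilon,\varepsilon],\,f_\varepsilon)$, $f_\varepsilon(x,t)=f(x)+t$ (with the full structure described in the context). Then the interleaving distance $d_{((\mathbf{Top}\downarrow\mathbb{R}),\mathcal{T})}$ coincides with the distance $d_\infty$: for all $\mathbb{R}$-spaces $(\mathbb{X},f)$ and $(\mathbb{Y},g)$, $$d_{((\mathbf{Top}\downarrow\mathbb{R}),\mathcal{T})}((\mathbb{X},f),(\mathbb{Y},g))=d_\infty((\mathbb{X},f),(\mathbb{Y},g)).$$
   Context: $(\mathbf{Top}\downarrow\mathbb{R})$ is the slice category: objects ($\mathbb{R}$-spaces) are pairs $(\mathbb{X},f)$ with $\mathbb{X}$ a topological space and $f:\mathbb{X}\to\mathbb{R}$ continuous; morphisms $\phi:(\mathbb{X},f)\to(\mathbb{Y},g)$ are continuous maps $\phi:\mathbb{X}\to\mathbb{Y}$ with $g\circ\phi=f$. $d_\infty((\mathbb{X},f),(\mathbb{Y},g))=\inf_{\Phi}\sup_{x\in\mathbb{X}}|f(x)-g(\Phi(x))|$, where $\Phi$ runs over all homeomorphisms $\Phi:\mathbb{X}\to\mathbb{Y}$ and suprema are taken in $[0,\infty]$; it is $\infty$ if $\mathbb{X},\mathbb{Y}$ are not homeomorphic. A flow $\mathcal{T}=(\mathcal{T},u,\mu)$ on a category $\mathcal{C}$ consists of: a functor $\mathcal{T}:([0,\infty),\le)\to\mathrm{End}(\mathcal{C})$,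 $\varepsilon\mapsto\mathcal{T}_\varepsilon$ (with $\mathcal{T}_{(\varepsilon\le\zeta)}:\mathcal{T}_\varepsilon\Rightarrow\mathcal{T}_\zeta$ the natural transformation assigned to $\varepsilon\le\zeta$); a natural transformation $u:I_{\mathcal{C}}\Rightarrow\mathcal{T}_0$; and natural transformations $\mu_{\varepsilon,\zeta}:\mathcal{T}_\varepsilon\mathcal{T}_\zeta\Rightarrow\mathcal{T}_{\varepsilon+\zeta}$ for all $\varepsilon,\zeta\ge0$; such that for all $\varepsilon,\zeta,\delta,\kappa\ge 0$: (i) $\mu_{0,\varepsilon}\circ(u\,\mathcal{T}_\varepsilon)=\mathrm{id}_{\mathcal{T}_\varepsilon}$ and $\mu_{\varepsilon,0}\circ(\mathcal{T}_\varepsilon u)=\mathrm{id}_{\mathcal{T}_\varepsilon}$; (ii) $\mu_{\varepsilon,\zeta+\delta}\circ(\mathcal{T}_\varepsilon\mu_{\zeta,\delta})=\mu_{\varepsilon+\zeta,\delta}\circ(\mu_{\varepsilon,\zeta}\mathcal{T}_\delta)$; (iii) $\mu_{\delta,\kappa}\circ(\mathcal{T}_{(\varepsilon\le\delta)}\mathcal{T}_{(\zeta\le\kappa)})=\mathcal{T}_{(\varepsilon+\zeta\le\delta+\kappa)}\circ\mu_{\varepsilon,\zeta}$ whenever $\varepsilon\le\delta$ and $\zeta\le\kappa$. A weak $\varepsilon$-interleaving of objects $a,b$ of $\mathcal{C}$ is a pair of morphisms $\varphi:a\to\mathcal{T}_\varepsilon b$, $\psi:b\to\mathcal{T}_\varepsilon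 a$ such that $\mu_{\varepsilon,\varepsilon,a}\circ\mathcal{T}_\varepsilon\psi\circ\varphi=\mathcal{T}_{(0\le2\varepsilon),a}\circ u_a$ and $\mu_{\varepsilon,\varepsilon,b}\circ\mathcal{T}_\varepsilon\varphi\circ\psi=\mathcal{T}_{(0\le2\varepsilon),b}\circ u_b$. The interleaving distance is $d_{(\mathcal{C},\mathcal{T})}(a,b)=\inf\{\varepsilon\ge0\mid \text{there is a weak }\varepsilon\text{-interleaving of }a,b\}$, with value $\infty$ if there is none for any $\varepsilon$. The flow $\mathcal{T}$ on $(\mathbf{Top}\downarrow\mathbb{R})$: $\mathcal{T}_\varepsilon(\mathbb{X},f)=(\mathbb{X}_\varepsilon,f_\varepsilon)$ with $\mathbb{X}_\varepsilon=\mathbb{X}\times[-\varepsilon,\varepsilon]$ and $f_\varepsilon(x,t)=f(x)+t$; $\mathcal{T}_\varepsilon[\phi](x,t)=(\phi(x),t)$; $\mathcal{T}_{(\varepsilon\le\zeta)}:(\mathbb{X}_\varepsilon,f_\varepsilon)\to(\mathbb{X}_\zeta,f_\zeta)$, $(x,t)\mapsto(x,t)$; $u:(\mathbb{X},f)\to(\mathbb{X}_0,f_0)$, $x\mapsto(x,0)$; $\mu_{\varepsilon,\zeta}:((\mathbb{X}_\zeta)_\varepsilon,(f_\zeta)_\varepsilon)\to(\mathbb{X}_{\varepsilon+\zeta},f_{\varepsilon+\zeta})$, $((x,t),s)\mapsto(x,t+s)$. *)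

(* Defs.v *)
From HB Require Import structures.
From mathcomp Require Import all_boot all_order all_algebra.
From mathcomp Require Import all_classical all_reals all_analysis.

Set Implicit Arguments.
Unset Strict Implicit.
Unset Printing Implicit Defensive.
Import Order.TTheory GRing.Theory Num.Theory.
Import numFieldNormedType.Exports.
Local Open Scope classical_set_scope.
Local Open Scope ring_scope.
Local Obligation Tactic := idtac.

Record category := Category {
  obj :> Type;
  mor : obj -> obj -> Type;
  idm : forall a, mor a a;
  compm : forall a b c, mor b c -> mor a b -> mor a c;
  comp1m : forall a b (f : mor a b), compm (idm b) f = f;
  compm1 : forall a b (f : mor a b), compm f (idm a) = f;
  compmA : forall a b c d (h : mor c d) (g : mor b c) (f : mor a b),
    compm h (compm g f) = compm (compm h g) f }.
Arguments mor {_} a b.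
Arguments idm {_} a.
Arguments compm {_ a b c} g f.
Notation "g '\oc' f" := (compm g f) (at level 50, left associativity).

(* The identity, seen as a morphism between provably equal objects.  The axioms
   of a flow silently identify objects such as T_(e + (z + d)) a and
   T_((e + z) + d) a, which are equal but not convertible. *)
Definition eqhom (C : category) (a b : C) (p : a = b) : mor a b :=
  match p in _ = b' return mor a b' with erefl => idm a end.

Record functor (C D : category) := Functor {
  fobj :> C -> D;
  fmor : forall a b, mor a b -> mor (fobj a) (fobj b);
  fmor_id : forall a, fmor (idm a) = idm (fobj a);
  fmor_comp : forall a b c (g : mor b c) (f : mor a b),
    fmor (g \oc f) = fmor g \oc fmor f }.
Arguments fmor {C D} _ {a b} f.

Program Definition idfunctor (C : category) : functor C C :=
  @Functor C C (fun a => a) (fun a b f => f) _ _.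
Next Obligation. by []. Qed.
Next Obligation. by []. Qed.

Program Definition compfunctor (B C D : category)
    (G : functor C D) (F : functor B C) : functor B D :=
  @Functor B D (fun a => G (F a)) (fun a b f => fmor G (fmor F f)) _ _.
Next Obligation. by move=> B C D G F a /=; rewrite !fmor_id. Qed.
Next Obligation. by move=> B C D G F a b c g f /=; rewrite !fmor_comp. Qed.

Record nattrans (C D : category) (F G : functor C D) := NatTrans {
  component :> forall a, mor (F a) (G a);
  naturality : forall a b (f : mor a b),
    component b \oc fmor F f = fmor G f \oc component a }.

Lemma nattrans_eq (C D : category) (F G : functor C D) (s t : nattrans F G) :
  (forall a, s a = t a) -> s = t.
Proof.
case: s t => [s ns] [t nt] /= st.
have {}st : s = t by apply: functional_extensionality_dep.
by subst t; congr NatTrans; exact: Prop_irrelevance.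
Qed.

Program Definition idnat (C D : category) (F : functor C D) : nattrans F F :=
  @NatTrans C D F F (fun a => idm (F a)) _.
Next Obligation. by move=> C D F a b f; rewrite comp1m compm1. Qed.

Program Definition compnat (C D : category) (F G H : functor C D)
    (t : nattrans G H) (s : nattrans F G) : nattrans F H :=
  @NatTrans C D F H (fun a => t a \oc s a) _.
Next Obligation.
by move=> C D F G H t s a b f; rewrite -compmA naturality compmA naturality compmA.
Qed.

(* Horizontal composite: from G o F to G' o F'. *)
Program Definition hcompnat (B C D : category) (G G' : functor C D)
    (F F' : functor B C) (t : nattrans G G') (s : nattrans F F') :
    nattrans (compfunctor G F) (compfunctor G' F') :=
  @NatTrans B D _ _ (fun a => t (F' a) \oc fmor G (s a)) _.
Next Obligation.
move=> B C D G G' F F' t s a b f /=.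
by rewrite -compmA -fmor_comp (naturality s) fmor_comp compmA (naturality t) compmA.
Qed.

Program Definition End_cat (C : category) : category :=
  @Category (functor C C) (@nattrans C C) (@idnat C C) (@compnat C C) _ _ _.
Next Obligation. by move=> C F G s; apply: nattrans_eq => a /=; rewrite comp1m. Qed.
Next Obligation. by move=> C F G s; apply: nattrans_eq => a /=; rewrite compm1. Qed.
Next Obligation.
by move=> C F G H K s t r; apply: nattrans_eq => a /=; rewrite compmA.
Qed.

Section Nonneg.
Variable R : realType.
Implicit Types e z d k : {nonneg R}.

Definition nn0 : {nonneg R} := 0%:nng.
Definition nnadd e z : {nonneg R} := (e%:num + z%:num)%:nng.

Lemma nnadd0 e : nnadd e nn0 = e.
Proof. by apply/val_inj; rewrite /= addr0. Qed.

Lemma nn0add e : nnadd nn0 e = e.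
Proof. by apply/val_inj; rewrite /= add0r. Qed.

Lemma nnaddA e z d : nnadd e (nnadd z d) = nnadd (nnadd e z) d.
Proof. by apply/val_inj; rewrite /= addrA. Qed.

Lemma nn0_le e : nn0%:num <= e%:num.
Proof. by have : 0 <= e%:num by []. Qed.

Lemma nnadd_le e z d k : e%:num <= d%:num -> z%:num <= k%:num ->
  (nnadd e z)%:num <= (nnadd d k)%:num.
Proof. exact: lerD. Qed.

Program Definition nonneg_cat : category :=
  @Category {nonneg R} (fun e z => e%:num <= z%:num) (fun e => lexx _)
    (fun e z d zd ez => le_trans ez zd) _ _ _.
Next Obligation. by move=> *; exact: Prop_irrelevance. Qed.
Next Obligation. by move=> *; exact: Prop_irrelevance. Qed.
Next Obligation. by move=> *; exact: Prop_irrelevance. Qed.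

End Nonneg.
Arguments nn0 {R}.
Arguments nnadd {R} e z.
Arguments nn0_le {R} e.

Section Family.
Variables (R : realType) (C : category).
Variable T : functor (nonneg_cat R) (End_cat C).

Definition fam (e : {nonneg R}) : functor C C := T e.

Definition fam_le (e z : {nonneg R}) (ez : e%:num <= z%:num) :
  nattrans (fam e) (fam z) := @fmor _ _ T e z ez.

Definition fam_eq (e z : {nonneg R}) (ez : e = z) (a : C) :
  mor (fam e a) (fam z a) := eqhom (congr1 (fun d => fam d a) ez).

Lemma fam_eqE (e z : {nonneg R}) (ez : e = z) (le_ez : e%:num <= z%:num) (a : C) :
  fam_eq ez a = fam_le le_ez a.
Proof.
case: z / ez le_ez => le_ee; rewrite /fam_eq /= /fam_le.
have -> : le_ee = @idm (nonneg_cat R) e by exact: Prop_irrelevance.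
by rewrite fmor_id.
Qed.

End Family.
Arguments fam {R C} T e.
Arguments fam_le {R C} T {e z} ez.
Arguments fam_eq {R C} T {e z} ez a.

(* Equalities between natural transformations are stated at each object. *)
Record flow (R : realType) (C : category) := Flow {
  fT :> functor (nonneg_cat R) (End_cat C);
  fu : nattrans (idfunctor C) (fam fT nn0);
  fmu : forall e z : {nonneg R},
    nattrans (compfunctor (fam fT e) (fam fT z)) (fam fT (nnadd e z));
  flow_unitl : forall (e : {nonneg R}) (a : C),
    fam_eq fT (nn0add e) a \oc (fmu nn0 e a \oc fu (fam fT e a))
    = idm (fam fT e a);
  flow_unitr : forall (e : {nonneg R}) (a : C),
    fam_eq fT (nnadd0 e) a \oc (fmu e nn0 a \oc fmor (fam fT e) (fu a))
    = idm (fam fT e a);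
  flow_assoc : forall (e z d : {nonneg R}) (a : C),
    fam_eq fT (nnaddA e z d) a
      \oc (fmu e (nnadd z d) a \oc fmor (fam fT e) (fmu z d a))
    = fmu (nnadd e z) d a \oc fmu e z (fam fT d a);
  flow_le : forall (e z d k : {nonneg R})
      (ed : e%:num <= d%:num) (zk : z%:num <= k%:num) (a : C),
    fmu d k a \oc hcompnat (fam_le fT ed) (fam_le fT zk) a
    = fam_le fT (nnadd_le ed zk) a \oc fmu e z a }.
Arguments fu {R C} _.
Arguments fmu {R C} _ e z.

Section Interleaving.
Variables (R : realType) (C : category) (T : flow R C).
Implicit Types (a b : C) (e : {nonneg R}).

Definition weak_interleaving e a b
    (phi : mor a (fam T e b)) (psi : mor b (fam T e a)) : Prop :=
  fmu T e e a \oc (fmor (fam T e) psi \oc phi)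
    = fam_le T (nn0_le (nnadd e e)) a \oc fu T a
  /\ fmu T e e b \oc (fmor (fam T e) phi \oc psi)
    = fam_le T (nn0_le (nnadd e e)) b \oc fu T b.

Definition weakly_interleaved e a b : Prop :=
  exists (phi : mor a (fam T e b)) (psi : mor b (fam T e a)),
    weak_interleaving phi psi.

Definition interleaving_distance a b : \bar R :=
  ereal_inf [set (e%:num)%:E | e in [set e : {nonneg R} | weakly_interleaved e a b]].

End Interleaving.

Section RSpaces.
Variable R : realType.

Record rspace := RSpace {
  carrier :> topologicalType;
  rfun : carrier -> R;
  rfun_continuous : continuous rfun }.
Arguments rfun : clear implicits.

Record rmap (X Y : rspace) := RMap {
  rmap_fun :> X -> Y;
  rmap_continuous : continuous rmap_fun;
  rmap_over : forall x, rfun Y (rmap_fun x) = rfun X x }.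

Lemma rmap_eq (X Y : rspace) (f g : rmap X Y) : (forall x, f x = g x) -> f = g.
Proof.
case: f g => [f cf of_] [g cg og] /= fg.
have {}fg : f = g by apply/funext.
by subst g; congr RMap; exact: Prop_irrelevance.
Qed.

Program Definition rmap_id (X : rspace) : rmap X X := @RMap X X idfun _ _.
Next Obligation. by move=> X x; exact: cvg_id. Qed.
Next Obligation. by []. Qed.

Program Definition rmap_comp (X Y Z : rspace) (g : rmap Y Z) (f : rmap X Y) :
  rmap X Z := @RMap X Z (g \o f) _ _.
Next Obligation.
move=> X Y Z g f x.
by apply: continuous_comp; [exact: rmap_continuous|exact: rmap_continuous].
Qed.
Next Obligation. by move=> X Y Z g f x /=; rewrite !rmap_over. Qed.

Program Definition Top_over_R : category :=
  @Category rspace rmap rmap_id rmap_comp _ _ _.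
Next Obligation. by move=> *; exact: rmap_eq. Qed.
Next Obligation. by move=> *; exact: rmap_eq. Qed.
Next Obligation. by move=> *; exact: rmap_eq. Qed.

(* [-e, e] with the topology induced from R *)
Definition segment (e : {nonneg R}) : topologicalType :=
  set_type `[- e%:num, e%:num]%classic.

Lemma segmentP e (t : segment e) : - e%:num <= set_val t <= e%:num.
Proof. by have := set_valP t; rewrite /= in_itv. Qed.

Lemma mem_segment (e : {nonneg R}) (t : R) : - e%:num <= t <= e%:num ->
  t \in `[- e%:num, e%:num]%classic.
Proof. by move=> te; apply/mem_set; rewrite /= in_itv. Qed.

Definition seg e (t : R) (te : - e%:num <= t <= e%:num) : segment e :=
  SigSub (mem_segment te).

Lemma seg_eq e (s t : segment e) : set_val s = set_val t -> s = t.
Proof. exact: val_inj. Qed.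

Lemma continuous_segment (W : topologicalType) e (f : W -> segment e) :
  continuous (fun w => set_val (f w) : R) -> continuous f.
Proof.
move=> cf; apply: continuous_comp_initial; exact: cf.
Qed.

Lemma set_val_segment_continuous e : continuous (set_val : segment e -> R).
Proof. exact: initial_continuous. Qed.


Lemma thickening_continuous (e : {nonneg R}) (X : rspace) :
  continuous (fun p : X * segment e => rfun X p.1 + set_val p.2).
Proof.
move=> p; apply: cvgD.
  by apply: continuous_comp; [exact: cvg_fst|exact: rfun_continuous].
apply: (@continuous_comp _ _ _ snd (set_val : segment e -> R)).
  exact: cvg_snd.
exact: set_val_segment_continuous.
Qed.

Definition thickening (e : {nonneg R}) (X : rspace) : rspace :=
  RSpace (@thickening_continuous e X).

Lemma continuous_pair (W U V : topologicalType) (f : W -> U) (g : W -> V) :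
  continuous f -> continuous g -> continuous (fun w => (f w, g w)).
Proof. by move=> cf cg w; have := cvg_pair (cf w) (cg w); apply. Qed.

Lemma continuous_thickening (e : {nonneg R}) (W : topologicalType) (X : rspace)
    (f : W -> X) (g : W -> segment e) :
  continuous f -> continuous (fun w => set_val (g w) : R) ->
  continuous (fun w => (f w, g w) : thickening e X).
Proof.
by move=> cf cg; exact: (continuous_pair cf (continuous_segment cg)).
Qed.

Lemma thickening_fst_continuous (e : {nonneg R}) (X : rspace) :
  continuous (fun p : thickening e X => p.1).
Proof. by move=> p; exact: cvg_fst. Qed.

Lemma thickening_snd_continuous (e : {nonneg R}) (X : rspace) :
  continuous (fun p : thickening e X => set_val p.2 : R).
Proof.
move=> p; apply: (@continuous_comp _ _ _ snd (set_val : segment e -> R)).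
  exact: cvg_snd.
exact: set_val_segment_continuous.
Qed.

Lemma thickening_eq (e : {nonneg R}) (X : rspace) (p q : thickening e X) :
  p.1 = q.1 -> set_val p.2 = set_val q.2 -> p = q.
Proof. by case: p q => [x s] [y t] /= -> /seg_eq ->. Qed.

Program Definition thickening_map (e : {nonneg R}) (X Y : rspace)
    (phi : rmap X Y) : rmap (thickening e X) (thickening e Y) :=
  @RMap (thickening e X) (thickening e Y) (fun p => (phi p.1, p.2)) _ _.
Next Obligation.
move=> e X Y phi; apply: continuous_thickening.
  move=> p; apply: continuous_comp; first exact: thickening_fst_continuous.
  exact: rmap_continuous.
exact: thickening_snd_continuous.
Qed.
Next Obligation. by move=> e X Y phi p /=; rewrite rmap_over. Qed.

Program Definition thickening_functor (e : {nonneg R}) :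
    functor Top_over_R Top_over_R :=
  @Functor Top_over_R Top_over_R (thickening e) (@thickening_map e) _ _.
Next Obligation. by move=> e X; apply: rmap_eq => -[]. Qed.
Next Obligation. by move=> e X Y Z g f; apply: rmap_eq => -[]. Qed.

Lemma segment_le (e z : {nonneg R}) (t : R) : e%:num <= z%:num ->
  - e%:num <= t <= e%:num -> - z%:num <= t <= z%:num.
Proof.
move=> ez /andP[et te].
by rewrite (le_trans te ez) andbT (le_trans _ et)// lerN2.
Qed.

Program Definition thickening_incl_map (e z : {nonneg R})
    (ez : e%:num <= z%:num) (X : rspace) : rmap (thickening e X) (thickening z X) :=
  @RMap (thickening e X) (thickening z X)
    (fun p => (p.1, seg (segment_le ez (segmentP p.2)))) _ _.
Next Obligation.
move=> e z ez X; apply: continuous_thickening.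
  exact: thickening_fst_continuous.
exact: thickening_snd_continuous.
Qed.
Next Obligation. by []. Qed.

Program Definition thickening_incl (e z : {nonneg R}) (ez : e%:num <= z%:num) :
    nattrans (thickening_functor e) (thickening_functor z) :=
  @NatTrans Top_over_R Top_over_R _ _ (thickening_incl_map ez) _.
Next Obligation.
by move=> e z ez X Y f; apply: rmap_eq => p; exact: thickening_eq.
Qed.

Program Definition thickening_family : functor (nonneg_cat R) (End_cat Top_over_R) :=
  @Functor (nonneg_cat R) (End_cat Top_over_R)
    thickening_functor (@thickening_incl) _ _.
Next Obligation.
move=> e; apply: nattrans_eq => X; apply: rmap_eq => p; exact: thickening_eq.
Qed.
Next Obligation.
move=> e z d zd ez; apply: nattrans_eq => X; apply: rmap_eq => p.
exact: thickening_eq.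
Qed.

Lemma segment_0 : - (@nn0 R)%:num <= (0 : R) <= (@nn0 R)%:num.
Proof. by rewrite /= oppr0 lexx. Qed.

Program Definition thickening_unit_map (X : rspace) : rmap X (thickening nn0 X) :=
  @RMap X (thickening nn0 X) (fun x => (x, seg segment_0)) _ _.
Next Obligation.
move=> X; apply: continuous_thickening; first by move=> x; exact: cvg_id.
by move=> x; exact: cvg_cst.
Qed.
Next Obligation. by move=> X x /=; rewrite addr0. Qed.

Program Definition thickening_unit :
    nattrans (idfunctor Top_over_R) (fam thickening_family nn0) :=
  @NatTrans Top_over_R Top_over_R _ _ thickening_unit_map _.
Next Obligation.
by move=> X Y f; apply: rmap_eq => x; exact: thickening_eq.
Qed.

Lemma segment_add (e z : {nonneg R}) (s t : R) :
  - e%:num <= s <= e%:num -> - z%:num <= t <= z%:num ->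
  - (nnadd e z)%:num <= t + s <= (nnadd e z)%:num.
Proof.
move=> /andP[es se] /andP[zt tz] /=.
by rewrite opprD [t + s]addrC !lerD.
Qed.

Program Definition thickening_mu_map (e z : {nonneg R}) (X : rspace) :
    rmap (thickening e (thickening z X)) (thickening (nnadd e z) X) :=
  @RMap (thickening e (thickening z X)) (thickening (nnadd e z) X)
    (fun p => (p.1.1, seg (segment_add (segmentP p.2) (segmentP p.1.2)))) _ _.
Next Obligation.
move=> e z X; apply: continuous_thickening.
  by move=> p; exact: (continuous_comp
    (@thickening_fst_continuous e (thickening z X) p)
    (@thickening_fst_continuous z X p.1)).
move=> p; apply: cvgD; last exact: thickening_snd_continuous.
exact: (continuous_comp (@thickening_fst_continuous e (thickening z X) p)
  (@thickening_snd_continuous z X p.1)).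
Qed.
Next Obligation. by move=> e z X p /=; rewrite addrA. Qed.

Program Definition thickening_mu (e z : {nonneg R}) :
    nattrans (compfunctor (fam thickening_family e) (fam thickening_family z))
             (fam thickening_family (nnadd e z)) :=
  @NatTrans Top_over_R Top_over_R _ _ (thickening_mu_map e z) _.
Next Obligation.
by move=> e z X Y f; apply: rmap_eq => p; exact: thickening_eq.
Qed.

Program Definition thickening_flow : flow R Top_over_R :=
  @Flow R Top_over_R thickening_family thickening_unit thickening_mu _ _ _ _.
Next Obligation.
move=> e X; rewrite fam_eqE; first by rewrite nn0add.
move=> le_e; apply: rmap_eq => p; apply: thickening_eq => //.
exact: addr0.
Qed.
Next Obligation.
move=> e X; rewrite fam_eqE; first by rewrite nnadd0.
move=> le_e; apply: rmap_eq => p; apply: thickening_eq => //.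
exact: add0r.
Qed.
Next Obligation.
move=> e z d X; rewrite fam_eqE; first by rewrite nnaddA.
move=> le_e; apply: rmap_eq => p; apply: thickening_eq => //.
exact/esym/addrA.
Qed.
Next Obligation.
by move=> e z d k ed zk X; apply: rmap_eq => p; exact: thickening_eq.
Qed.

Definition homeomorphism (X Y : topologicalType) (Phi : X -> Y) : Prop :=
  continuous Phi /\
  exists Psi : Y -> X, [/\ continuous Psi, cancel Phi Psi & cancel Psi Phi].

(* The supremum is taken in [0, +oo]: adjoining 0 gives the empty set the
   supremum 0 instead of -oo, and changes nothing otherwise. *)
Definition sup_dist (X Y : rspace) (Phi : X -> Y) : \bar R :=
  ereal_sup (0%E |` [set `|rfun X x - rfun Y (Phi x)|%:E | x in [set: X]]).

Definition d_infty (X Y : rspace) : \bar R :=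
  ereal_inf [set sup_dist Phi | Phi in [set Phi : X -> Y | homeomorphism Phi]].

End RSpaces.
Arguments rfun {R} _ _.

(* Main.v *)
Require Import Defs.
From mathcomp Require Import all_boot all_order all_algebra.
From mathcomp Require Import all_classical all_reals all_analysis.

(** A weak interleaving in this flow is the same thing as a homeomorphism that
    distorts the real-valued functions by at most [e].  A morphism from [X] to
    the [e]-thickening of [Y] over the reals is a map [Phi] together with a
    height in [-e, e], and compatibility with the projections forces that
    height to be the difference of the function of [X] and that of [Y] along
    [Phi].  Such a morphism is hence just a continuous [Phi] with distortion at
    most [e] ([shift_map] and [thickened_map_dist]).  On first components, the
    two interleaving identities say precisely that the underlying maps are
    mutually inverse; on second components they hold automatically, because
    the two heights are opposite.  This is [weakly_interleavedP], which
    describes the set of interleaving parameters as the upward closure of the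
    set of finite distortions of homeomorphisms.  The two sets therefore have
    the same infimum, the infinite distortions having no effect on it. *)

Set Implicit Arguments.
Unset Strict Implicit.
Unset Printing Implicit Defensive.
Import Order.TTheory GRing.Theory Num.Theory.
Import numFieldNormedType.Exports.
Local Open Scope classical_set_scope.
Local Open Scope ring_scope.

Section Distortion.
Variable R : realType.
Implicit Types (X Y : rspace R) (e : {nonneg R}).

Lemma sup_dist_ge0 X Y (Phi : X -> Y) : (0 <= sup_dist Phi)%E.
Proof. by apply: ereal_sup_ubound; left. Qed.

Lemma sup_dist_leP X Y (Phi : X -> Y) e :
  (sup_dist Phi <= (e%:num)%:E)%E <->
  forall x, `|rfun X x - rfun Y (Phi x)| <= e%:num.
Proof.
split=> [le_e x|le_e].
  rewrite -lee_fin; apply: le_trans le_e.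
  by apply: ereal_sup_ubound; right; exists x.
apply: ge_ereal_sup => _ [->|[x _ <-]]; first by rewrite lee_fin.
by rewrite lee_fin.
Qed.

(** The height of a point of the thickening is the defect of its first
    component from lying over the same real number. *)
Lemma thickened_map_dist X Y e (phi : rmap X (thickening e Y)) (x : X) :
  `|rfun X x - rfun Y (phi x).1| <= e%:num.
Proof.
rewrite -(rmap_over phi x) /= addrAC subrr add0r ler_norml.
exact: segmentP.
Qed.

Section ShiftMap.
Variables (X Y : rspace R) (e : {nonneg R}) (Phi : X -> Y).
Hypothesis cPhi : continuous Phi.
Hypothesis le_e : forall x, `|rfun X x - rfun Y (Phi x)| <= e%:num.

Let height_in_segment x :
  - e%:num <= rfun X x - rfun Y (Phi x) <= e%:num.
Proof. by rewrite -ler_norml. Qed.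

Let shift_fun (x : X) : thickening e Y := (Phi x, seg (height_in_segment x)).

Let shift_fun_continuous : continuous shift_fun.
Proof.
apply: continuous_thickening => // x.
apply: cvgB; first exact: rfun_continuous.
by apply: continuous_comp; [exact: cPhi|exact: rfun_continuous].
Qed.

Let shift_fun_over x : rfun (thickening e Y) (shift_fun x) = rfun X x.
Proof. by rewrite /= addrC subrK. Qed.

(** A continuous map of distortion at most [e] becomes a map over the reals
    once the defect is recorded as the height in the thickening. *)
Definition shift_map : rmap X (thickening e Y) :=
  RMap shift_fun_continuous shift_fun_over.

End ShiftMap.

(** One interleaving identity holds as soon as the maps cancel: the heights at
    [x] and at [Phi x] then add up to zero. *)
Lemma shift_map_cancel X Y e (Phi : X -> Y) (Psi : Y -> X)
    (cPhi : continuous Phi) (cPsi : continuous Psi)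
    (Phi_le : forall x, `|rfun X x - rfun Y (Phi x)| <= e%:num)
    (Psi_le : forall y, `|rfun Y y - rfun X (Psi y)| <= e%:num) :
  cancel Phi Psi ->
  rmap_comp (thickening_mu_map e e X)
      (rmap_comp (thickening_map e (shift_map cPsi Psi_le))
                 (shift_map cPhi Phi_le))
    = rmap_comp (thickening_incl_map (nn0_le (nnadd e e)) X)
                (thickening_unit_map X).
Proof.
move=> PhiK; apply: rmap_eq => x; apply: thickening_eq; first exact: PhiK.
change ((rfun Y (Phi x) - rfun X (Psi (Phi x)))
        + (rfun X x - rfun Y (Phi x)) = 0).
by rewrite PhiK addrC subrKA subrr.
Qed.

Lemma weakly_interleavedP X Y e :
  weakly_interleaved (thickening_flow R) e X Y <->
  exists2 Phi : X -> Y, homeomorphism Phi & (sup_dist Phi <= (e%:num)%:E)%E.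
Proof.
split=> [[phi [psi [phiK psiK]]]|[Phi [cPhi [Psi [cPsi PhiK PsiK]]]]].
  have fst_cont (A B : rspace R) (h : rmap A (thickening e B)) :
      continuous (fun a => (h a).1).
    move=> a; apply: continuous_comp; first exact: rmap_continuous.
    exact: thickening_fst_continuous.
  exists (fun x => (rmap_fun phi x).1); last first.
    by apply/sup_dist_leP; exact: thickened_map_dist.
  split; first exact: fst_cont.
  exists (fun y => (rmap_fun psi y).1); split; first exact: fst_cont.
  - by move=> x; exact: (congr1 (fun h : rmap X (thickening _ X) => (h x).1) phiK).
  - by move=> y; exact: (congr1 (fun h : rmap Y (thickening _ Y) => (h y).1) psiK).
move=> /sup_dist_leP Phi_le.
have Psi_le y : `|rfun Y y - rfun X (Psi y)| <= e%:num.
  by rewrite distrC -{2}(PsiK y).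
exists (shift_map cPhi Phi_le), (shift_map cPsi Psi_le).
by split; exact: shift_map_cancel.
Qed.

End Distortion.

Theorem theorem3p11 (R : realType) (X Y : rspace R) :
  interleaving_distance (thickening_flow R) X Y = d_infty X Y.
Proof.
apply/eqP; rewrite eq_le; apply/andP; split.
  apply: le_ereal_inf_tmp => _ [Phi homPhi <-].
  have [fin_d|] := boolP (sup_dist Phi \is a fin_num); last first.
    by rewrite ge0_fin_numE ?sup_dist_ge0// -leNgt leye_eq => /eqP ->; exact: leey.
  have d_ge0 : 0 <= fine (sup_dist Phi) by rewrite fine_ge0// sup_dist_ge0.
  (* A finite distortion is itself an interleaving parameter. *)
  apply: ereal_inf_lbound; exists (NngNum d_ge0); last by rewrite /= fineK.
  by apply/weakly_interleavedP; exists Phi => //=; rewrite fineK.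
apply: le_ereal_inf_tmp => _ [e /weakly_interleavedP[Phi homPhi le_e] <-].
by apply: le_trans le_e; apply: ereal_inf_lbound; exists Phi.
Qed.
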